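(* Let $G$ be a short game. (1) If $G\lhd 2^{-n}$ for all positive integers $n$, then there is some positive integer $m$ such that $G\lhd m\,{\uparrow}$. (2) If $G\le 2^{-n}$ for all positive integers $n$, then there is some positive integer $m$ such that $G\le m\,{\uparrow}$.
   Context: A game is an ordered pair $G=(L,R)$ of sets of games, where $L$ is the set of left options and $R$ the set of right options, subject to the Descending Game Condition: there is no infinite sequence of games $G^0,G^1,G^2,\dots$ in which every $G^{i+1}$ is a left or right option of $G^i$. The sets $L,R$ may be empty or infinite. One writes $G=\{G^L,\dots\mid G^R,\dots\}$, where $G^L$ and $G^R$ denote arbitrary left and right options of $G$. The positions of $G$ are $G$ itself and all positions of its options; $G$ is short if it has only finitely many positions. Order, defined recursively: $G\ge 0$ iff there is no right option $G^R$ with $G^R\le 0$; $G\le 0$ iff there is no left option $G^L$ with $G^L\ge 0$. $G\lhd 0$ means that $G\ge 0$ is false. Arithmetic, defined recursively: $G+H$ has left options all $G^L+H$ and all $G+H^L$, and right options all $G^R+H$ and all $G+H^R$; $-G$ has left options all $-G^R$ and right options all $-G^L$; $G-H$ is $G+(-H)$. For two games, $G\le H$ means $G-H\le 0$, and $G\lhd H$ means $G-H\lhd 0$. Notation: $0=\{\,\mid\,\}$, $\star=\{0\mid 0\}$, ${\uparrow}=\{0\mid\star\}$; $m\,{\uparrow}$ is the sum of $m$ copies of ${\uparrow}$. For natural numbers $n$, $2^{-n}$ is the game defined recursively by $2^{-n}=\{0\mid 2^{-k}: 0\le k<n\}$ (so $2^{-0}=\{0\mid\,\}=1$). *)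

(* Defs.v *)
From mathcomp Require Import all_boot.

Set Implicit Arguments.
Unset Strict Implicit.
Unset Printing Implicit Defensive.

(* Sets of options are given by families indexed by arbitrary types, empty or
   infinite, as for Aczel's sets: the index types are not data of the game, and
   two games are identical as pairs of sets when they are related by [game_ext]
   below, which is coarser than Leibniz equality. The Descending Game Condition
   holds by well-foundedness of the inductive type (see
   [descending_game_condition]). *)
Inductive game : Type :=
  Game (I J : Type) (gL : I -> game) (gR : J -> game).

Definition is_left_option (X G : game) : Prop :=
  let: Game _ _ gL _ := G in exists i, X = gL i.

Definition is_right_option (X G : game) : Prop :=
  let: Game _ _ _ gR := G in exists j, X = gR j.

Definition is_option (X G : game) : Prop :=
  is_left_option X G \/ is_right_option X G.

Lemma descending_game_condition (s : nat -> game) :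
  ~ (forall i, is_option (s i.+1) (s i)).
Proof.
move=> ds; move: {-2}(s 0) (erefl (s 0)) => G.
move: {1}0 => k; elim: G k => I J gL IHL gR IHR k def_s.
have := ds k; rewrite -def_s => -[] [i def_si].
  by apply: (IHL i k.+1); rewrite def_si.
by apply: (IHR i k.+1); rewrite def_si.
Qed.

(* Equality of games as ordered pairs of sets, i.e., hereditary extensional
   identity; this is much finer than the game-theoretic equality
   G <= H <= G. *)
Fixpoint game_ext (G H : game) {struct G} : Prop :=
  let: Game IG JG GL GR := G in
  let: Game IH JH HL HR := H in
  [/\ forall i, exists k, game_ext (GL i) (HL k),
      forall k, exists i, game_ext (GL i) (HL k),
      forall j, exists k, game_ext (GR j) (HR k)
    & forall k, exists j, game_ext (GR j) (HR k)].

Inductive position (G : game) : game -> Prop :=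
| position_self : position G G
| position_option X P : is_option X G -> position X P -> position G P.

(* Positions are counted up to [game_ext], the identity of games as sets. *)
Definition short (G : game) : Prop :=
  exists (n : nat) (p : 'I_n -> game),
    forall P, position G P -> exists i, game_ext P (p i).

Fixpoint ge0 (G : game) : Prop :=
  let: Game _ _ _ gR := G in ~ exists j, le0 (gR j)
with le0 (G : game) : Prop :=
  let: Game _ _ gL _ := G in ~ exists i, ge0 (gL i).

Definition lf0 (G : game) : Prop := ~ ge0 G.

Fixpoint gadd (G : game) : game -> game :=
  fix gaddG (H : game) : game :=
    let: Game IG JG GL GR := G in
    let: Game IH JH HL HR := H in
    @Game (IG + IH) (JG + JH)
      (fun i => match i with
                | inl a => gadd (GL a) H
                | inr b => gaddG (HL b)
                end)
      (fun j => match j with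
                | inl a => gadd (GR a) H
                | inr b => gaddG (HR b)
                end).

Fixpoint gopp (G : game) : game :=
  let: Game _ _ gL gR := G in
  Game (fun j => gopp (gR j)) (fun i => gopp (gL i)).

Definition gsub (G H : game) : game := gadd G (gopp H).

Definition gle (G H : game) : Prop := le0 (gsub G H).

Definition glf (G H : game) : Prop := lf0 (gsub G H).

Definition gzero : game := @Game void void (@of_void _) (@of_void _).

(* {L | R} for finite lists. The index type is a sigma type in [Set] and not
   'I_(size L), because the latter lives in the universe of [predArgType], which
   would then have to be below that of [game]. The default value of [nth] is
   never used. *)
Definition fin_game (L R : seq game) : game :=
  @Game {k : nat | k < size L} {k : nat | k < size R}
    (fun i => nth gzero L (sval i)) (fun j => nth gzero R (sval j)).

Definition gstar : game := fin_game [:: gzero] [:: gzero].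
Definition gup : game := fin_game [:: gzero] [:: gstar].

(* m copies of the game up; [iterop] adds no spurious zero when m > 0. *)
Definition gups (m : nat) : game := iterop m gadd gup gzero.

(* The sequence 2^-0, ..., 2^-(n-1). *)
Fixpoint pow2negs (n : nat) : seq game :=
  if n is k.+1 then rcons (pow2negs k) (fin_game [:: gzero] (pow2negs k))
  else [::].

Definition pow2neg (n : nat) : game := fin_game [:: gzero] (pow2negs n).

(* The defining recursion 2^-n = {0 | 2^-k : 0 <= k < n}. *)
Lemma pow2negE (n : nat) :
  pow2neg n = fin_game [:: gzero] [seq pow2neg k | k <- iota 0 n].
Proof.
congr (fin_game _ _); elim: n => // n IHn.
by rewrite -[in RHS]addn1 iotaD map_cat -IHn cats1.
Qed.

(* Main.v *)
Require Import Defs.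
From mathcomp Require Import all_boot.
From Stdlib Require Import Classical.

(** The two claims are proved simultaneously by induction on [G]; in the order
    on games, [G <= H] fails exactly when some [G^L >= H] or some [H^R <= G].

    If [G] is less than or fuzzy with every [2^-n], then for each [n] either
    [G <= 0], since 0 is the only left option of [2^-n], or some right option
    of [G] is at most [2^-n]. The [2^-n] decrease and [G] has finitely many
    right options, so one of these is at most [2^-n] for all [n]
    ([glf_pow2neg_right_option]). By induction that option is at most some
    multiple of up, which gives (1).

    For (2), each of the finitely many left options of [G] falls under (1), so
    that all of them are less than or fuzzy with one and the same multiple of
    up. It remains to see that no right option of [m up] is at most [G].
    Such an option is equal to [(m-1) up + star]. On the other hand
    [G <= 2^-(n+1)] makes [G] less than or fuzzy with the right option [2^-n]
    of [2^-(n+1)], so the previous paragraph applies: either [G <= 0] and there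
    is nothing to prove, or some right option of [G] is at most [k up]. As
    [2 up + star >= 0], this is at most [(m-1) up + star] once [m >= k+3]
    ([gups_le_right_option]), whereas no game is at least one of its
    right options. *)

(** * Options and the recursive description of the order *)

Lemma game_option_ind (P : game -> Prop) :
  (forall G, (forall X, is_left_option X G -> P X) ->
             (forall X, is_right_option X G -> P X) -> P G) ->
  forall G, P G.
Proof.
by move=> IH; elim=> I J gL IHL gR IHR; apply: IH => X [i ->].
Qed.

Lemma left_option_gadd {X G H} : is_left_option X (gadd G H) <->
  (exists2 Y, is_left_option Y G & X = gadd Y H) \/
  (exists2 Y, is_left_option Y H & X = gadd G Y).
Proof.
case: G => IG JG GL GR; case: H => IH JH HL HR; split=> [[[a|b] ->]|].
- by left; exists (GL a) => //; exists a.
- by right; exists (HL b) => //; exists b.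
by case=> [[_ [a ->] ->]|[_ [b ->] ->]]; [exists (inl a)|exists (inr b)].
Qed.

Lemma right_option_gadd {X G H} : is_right_option X (gadd G H) <->
  (exists2 Y, is_right_option Y G & X = gadd Y H) \/
  (exists2 Y, is_right_option Y H & X = gadd G Y).
Proof.
case: G => IG JG GL GR; case: H => IH JH HL HR; split=> [[[a|b] ->]|].
- by left; exists (GR a) => //; exists a.
- by right; exists (HR b) => //; exists b.
by case=> [[_ [a ->] ->]|[_ [b ->] ->]]; [exists (inl a)|exists (inr b)].
Qed.

Lemma left_option_gaddl {X G} H :
  is_left_option X G -> is_left_option (gadd X H) (gadd G H).
Proof. by move=> hX; apply/left_option_gadd; left; exists X. Qed.

Lemma left_option_gaddr {X H} G :
  is_left_option X H -> is_left_option (gadd G X) (gadd G H).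
Proof. by move=> hX; apply/left_option_gadd; right; exists X. Qed.

Lemma right_option_gaddl {X G} H :
  is_right_option X G -> is_right_option (gadd X H) (gadd G H).
Proof. by move=> hX; apply/right_option_gadd; left; exists X. Qed.

Lemma right_option_gaddr {X H} G :
  is_right_option X H -> is_right_option (gadd G X) (gadd G H).
Proof. by move=> hX; apply/right_option_gadd; right; exists X. Qed.

Lemma left_option_gopp {X G} : is_left_option X (gopp G) <->
  exists2 Y, is_right_option Y G & X = gopp Y.
Proof.
case: G => I J gL gR; split=> [[j ->]|[_ [j ->] ->]]; last by exists j.
by exists (gR j) => //; exists j.
Qed.

Lemma right_option_gopp {X G} : is_right_option X (gopp G) <->
  exists2 Y, is_left_option Y G & X = gopp Y.
Proof.
case: G => I J gL gR; split=> [[j ->]|[_ [j ->] ->]]; last by exists j.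
by exists (gL j) => //; exists j.
Qed.

Lemma le0P {G} : le0 G <-> forall X, is_left_option X G -> ~ ge0 X.
Proof.
case: G => I J gL gR; split=> [h _ [i ->] hi|h [i hi]]; first by apply: h; exists i.
by apply: (h (gL i)) => //; exists i.
Qed.

Lemma ge0P {G} : ge0 G <-> forall X, is_right_option X G -> ~ le0 X.
Proof.
case: G => I J gL gR; split=> [h _ [i ->] hi|h [i hi]]; first by apply: h; exists i.
by apply: (h (gR i)) => //; exists i.
Qed.

Lemma le0_gsubP {G H} : le0 (gsub G H) <->
  (forall X, is_left_option X G -> ~ ge0 (gsub X H)) /\
  (forall Y, is_right_option Y H -> ~ ge0 (gsub G Y)).
Proof.
rewrite le0P; split=> [h|[hG hH] X /left_option_gadd].
  split=> X hX; apply: h; apply/left_option_gadd; first by left; exists X.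
  by right; exists (gopp X) => //; apply/left_option_gopp; exists X.
by case=> [[Y /hG hY ->]|[_ /left_option_gopp[Y /hH hY ->] ->]].
Qed.

Lemma ge0_gsubP {G H} : ge0 (gsub G H) <->
  (forall X, is_right_option X G -> ~ le0 (gsub X H)) /\
  (forall Y, is_left_option Y H -> ~ le0 (gsub G Y)).
Proof.
rewrite ge0P; split=> [h|[hG hH] X /right_option_gadd].
  split=> X hX; apply: h; apply/right_option_gadd; first by left; exists X.
  by right; exists (gopp X) => //; apply/right_option_gopp; exists X.
by case=> [[Y /hG hY ->]|[_ /right_option_gopp[Y /hH hY ->] ->]].
Qed.

(** Reversing a difference exchanges the two players. The two equivalences
    feed each other, since passing to an option exchanges [ge0] and [le0]. *)
Lemma gsub_reverse G H :
  (ge0 (gsub G H) <-> le0 (gsub H G)) /\ (le0 (gsub G H) <-> ge0 (gsub H G)).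
Proof.
elim/game_option_ind: G H => G IGL IGR; elim/game_option_ind=> H IHL IHR.
split; rewrite ge0_gsubP le0_gsubP; split=> -[h1 h2]; split=> X hX hX0.
- by apply: (h2 X hX); apply/(proj2 (IHL X hX)).
- by apply: (h1 X hX); apply/(proj2 (IGR X hX H)).
- by apply: (h2 X hX); apply/(proj2 (IGR X hX H)).
- by apply: (h1 X hX); apply/(proj2 (IHL X hX)).
- by apply: (h2 X hX); apply/(proj1 (IHR X hX)).
- by apply: (h1 X hX); apply/(proj1 (IGL X hX H)).
- by apply: (h2 X hX); apply/(proj1 (IGL X hX H)).
by apply: (h1 X hX); apply/(proj1 (IHR X hX)).
Qed.

Lemma glfE G H : glf G H <-> ~ gle H G.
Proof. by rewrite /glf /lf0 (proj1 (gsub_reverse G H)). Qed.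

(** Conway's recursion for the order, which replaces the definition by
    differences in all that follows. *)
Lemma gleP {G H} : gle G H <->
  (forall X, is_left_option X G -> ~ gle H X) /\
  (forall Y, is_right_option Y H -> ~ gle Y G).
Proof.
rewrite /gle le0_gsubP; split=> -[hG hH]; split=> X hX.
- by rewrite -(proj1 (gsub_reverse X H)); apply: hG.
- by rewrite -(proj1 (gsub_reverse G X)); apply: hH.
- by rewrite (proj1 (gsub_reverse X H)); apply: hG.
by rewrite (proj1 (gsub_reverse G X)); apply: hH.
Qed.

Lemma not_gle {G H} : ~ gle G H ->
  (exists2 X, is_left_option X G & gle H X) \/
  (exists2 Y, is_right_option Y H & gle Y G).
Proof.
move=> nGH; apply: NNPP => nX; apply: nGH; apply/gleP.
by split=> X hX hle; apply: nX; [left|right]; exists X.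
Qed.

(** * Games form a preordered commutative monoid *)

Lemma gle_refl G : gle G G.
Proof.
elim/game_option_ind: G => G IL IR; apply/gleP; split=> X hX /gleP[hL hR].
  by apply: (hL X hX); apply: IL.
by apply: (hR X hX); apply: IR.
Qed.

(** The induction step turns [G <= H <= K] into the chain [H <= K <= G^L] or
    [K^R <= G <= H], hence the three cyclic rotations in the statement. *)
Lemma gle_trans_rotations G H K :
  [/\ gle G H -> gle H K -> gle G K,
      gle H K -> gle K G -> gle H G
    & gle K G -> gle G H -> gle K H].
Proof.
elim/game_option_ind: G H K => G GL GR.
elim/game_option_ind=> H HL HR; elim/game_option_ind=> K KL KR.
split=> h1 h2; apply/gleP; split=> X hX h3.
- by case: (GL X hX H K) => _ h _; move/gleP: h1 => [/(_ X hX) + _]; apply; apply: h.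
- by case: (KR X hX) => _ _ h; move/gleP: h2 => [_ /(_ X hX)]; apply; apply: h.
- by case: (HL X hX K) => _ _ h; move/gleP: h1 => [/(_ X hX) + _]; apply; apply: h.
- by case: (GR X hX H K) => h _ _; move/gleP: h2 => [_ /(_ X hX)]; apply; apply: h.
- by case: (KL X hX) => h _ _; move/gleP: h1 => [/(_ X hX) + _]; apply; apply: h.
by case: (HR X hX K) => _ h _; move/gleP: h2 => [_ /(_ X hX)]; apply; apply: h.
Qed.

Lemma gle_trans {H G K} : gle G H -> gle H K -> gle G K.
Proof. by case: (gle_trans_rotations G H K). Qed.

Lemma left_option_not_ge {X G} : is_left_option X G -> ~ gle G X.
Proof. by move=> hX /gleP[/(_ X hX) + _]; apply; apply: gle_refl. Qed.

Lemma right_option_not_le {X G} : is_right_option X G -> ~ gle X G.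
Proof. by move=> hX /gleP[_ /(_ X hX)]; apply; apply: gle_refl. Qed.

(** Left answers every move in the difference of [H] and [G] by the
    corresponding move in the other component. *)
Lemma gle_dominated {G H} :
  (forall X, is_left_option X G -> exists2 Y, is_left_option Y H & gle X Y) ->
  (forall Y, is_right_option Y H -> exists2 X, is_right_option X G & gle X Y) ->
  gle G H.
Proof.
move=> hL hR; apply/gleP; split=> [X /hL[Y hY leXY] leHX|Y /hR[X hX leXY] leYG].
  by apply: (left_option_not_ge hY); apply: gle_trans leXY.
by apply: (right_option_not_le hX); apply: gle_trans leYG.
Qed.

Lemma game_ext_gle {G H} : game_ext G H -> gle G H /\ gle H G.
Proof.
elim: G H => IG JG GL IHL GR IHR [IH JH HL HR] [h1 h2 h3 h4].
split; apply: gle_dominated => _ [i ->].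
- by case: (h1 i) => k /IHL[? ?]; exists (HL k) => //; exists k.
- by case: (h4 i) => k /IHR[? ?]; exists (GR k) => //; exists k.
- by case: (h2 i) => k /IHL[? ?]; exists (GL k) => //; exists k.
by case: (h3 i) => k /IHR[? ?]; exists (HR k) => //; exists k.
Qed.

Lemma gadd_comm G H : gle (gadd G H) (gadd H G).
Proof.
elim/game_option_ind: G H => G GL GR; elim/game_option_ind=> H HL HR.
apply: gle_dominated => X; rewrite ?left_option_gadd ?right_option_gadd.
  case=> -[Y hY ->].
    by exists (gadd H Y); [apply: left_option_gaddr|apply: GL].
  by exists (gadd Y G); [apply: left_option_gaddl|apply: HL].
case=> -[Y hY ->].
  by exists (gadd G Y); [apply: right_option_gaddr|apply: HR].
by exists (gadd Y H); [apply: right_option_gaddl|apply: GR].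
Qed.

Lemma gadd_assoc G H K :
  gle (gadd G (gadd H K)) (gadd (gadd G H) K) /\
  gle (gadd (gadd G H) K) (gadd G (gadd H K)).
Proof.
elim/game_option_ind: G H K => G GL GR.
elim/game_option_ind=> H HL HR; elim/game_option_ind=> K KL KR.
split; apply: gle_dominated => X; rewrite ?left_option_gadd ?right_option_gadd.
- case=> [[Y hY ->]|[_ /left_option_gadd[[Y hY ->]|[Y hY ->]] ->]].
  + by exists (gadd (gadd Y H) K); [do 2!apply: left_option_gaddl|case: (GL Y hY H K)].
  + by exists (gadd (gadd G Y) K); [apply/left_option_gaddl/left_option_gaddr|case: (HL Y hY K)].
  by exists (gadd (gadd G H) Y); [apply: left_option_gaddr|case: (KL Y hY)].
- case=> [[_ /right_option_gadd[[Y hY ->]|[Y hY ->]] ->]|[Y hY ->]].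
  + by exists (gadd Y (gadd H K)); [apply: right_option_gaddl|case: (GR Y hY H K)].
  + by exists (gadd G (gadd Y K)); [apply/right_option_gaddr/right_option_gaddl|case: (HR Y hY K)].
  by exists (gadd G (gadd H Y)); [do 2!apply: right_option_gaddr|case: (KR Y hY)].
- case=> [[_ /left_option_gadd[[Y hY ->]|[Y hY ->]] ->]|[Y hY ->]].
  + by exists (gadd Y (gadd H K)); [apply: left_option_gaddl|case: (GL Y hY H K)].
  + by exists (gadd G (gadd Y K)); [apply/left_option_gaddr/left_option_gaddl|case: (HL Y hY K)].
  by exists (gadd G (gadd H Y)); [do 2!apply: left_option_gaddr|case: (KL Y hY)].
case=> [[Y hY ->]|[_ /right_option_gadd[[Y hY ->]|[Y hY ->]] ->]].
+ by exists (gadd (gadd Y H) K); [do 2!apply: right_option_gaddl|case: (GR Y hY H K)].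
+ by exists (gadd (gadd G Y) K); [apply/right_option_gaddl/right_option_gaddr|case: (HR Y hY K)].
by exists (gadd (gadd G H) Y); [apply: right_option_gaddr|case: (KR Y hY)].
Qed.

Lemma gadd0g G : gle (gadd gzero G) G /\ gle G (gadd gzero G).
Proof.
elim/game_option_ind: G => G GL GR; split; apply: gle_dominated => X.
- by move=> /left_option_gadd[[? []]//|[Y hY ->]]; exists Y => //; case: (GL Y hY).
- move=> hX; exists (gadd gzero X); last by case: (GR X hX).
  exact: right_option_gaddr.
- move=> hX; exists (gadd gzero X); last by case: (GL X hX).
  exact: left_option_gaddr.
by move=> /right_option_gadd[[? []]//|[Y hY ->]]; exists Y => //; case: (GR Y hY).
Qed.

(** Monotonicity and cancellation must be proved together: refuting
    [H + K <= G^L + K] from [G <= H] is cancellation for the smaller pair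
    [H], [G^L]. As that pair comes in the opposite order, both orders are
    part of the statement. *)
Lemma gle_gadd2r_both G H K :
  (gle G H <-> gle (gadd G K) (gadd H K)) /\
  (gle H G <-> gle (gadd H K) (gadd G K)).
Proof.
elim/game_option_ind: K G H => K KL KR.
elim/game_option_ind=> G GL GR; elim/game_option_ind=> H HL HR.
have step A B :
    (forall X, is_left_option X A -> gle B X <-> gle (gadd B K) (gadd X K)) ->
    (forall X, is_right_option X B -> gle X A <-> gle (gadd X K) (gadd A K)) ->
    gle A B <-> gle (gadd A K) (gadd B K).
  move=> hA hB; split=> /gleP[h1 h2]; apply/gleP; split.
  - move=> X /left_option_gadd[[Y hY ->]|[Y hY ->]].
      by rewrite -(hA Y hY); apply: h1.
    have hBY : is_left_option (gadd B Y) (gadd B K).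
      exact: left_option_gaddr.
    move=> /gleP[/(_ _ hBY) + _]; apply; rewrite -(proj1 (KL Y hY A B)).
    by apply/gleP.
  - move=> X /right_option_gadd[[Y hY ->]|[Y hY ->]].
      by rewrite -(hB Y hY); apply: h2.
    have hAY : is_right_option (gadd A Y) (gadd A K).
      exact: right_option_gaddr.
    move=> /gleP[_ /(_ _ hAY)]; apply; rewrite -(proj1 (KR Y hY A B)).
    by apply/gleP.
  - move=> X hX; rewrite (hA X hX); apply: h1.
    exact: left_option_gaddl.
  - move=> X hX; rewrite (hB X hX); apply: h2.
    exact: right_option_gaddl.
by split; apply: step => X hX; [case: (GL X hX H)|case: (HR X hX)
                               |case: (HL X hX)|case: (GR X hX H)].
Qed.

Lemma gle_gadd2r K {G H} : gle G H -> gle (gadd G K) (gadd H K).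
Proof. by case: (gle_gadd2r_both G H K) => -[]. Qed.

Lemma gle_gadd2l K {G H} : gle G H -> gle (gadd K G) (gadd K H).
Proof.
move=> /(gle_gadd2r K) leGH.
by apply: gle_trans (gadd_comm K G) _; apply: gle_trans leGH (gadd_comm H K).
Qed.

Lemma gle_addl {B} K : gle gzero B -> gle K (gadd B K).
Proof. by move=> /(gle_gadd2r K); apply: gle_trans; case: (gadd0g K). Qed.

Lemma gadd_ge0 G H : gle gzero G -> gle gzero H -> gle gzero (gadd G H).
Proof. by move=> hG hH; apply: gle_trans hH _; apply: gle_addl. Qed.

(** * Dyadic numbers and multiples of up *)

Lemma left_option_fin_game {X L R} : is_left_option X (fin_game L R) <->
  exists2 k, k < size L & X = nth gzero L k.
Proof.
split=> [[[k hk] ->]|[k hk ->]]; first by exists k.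
by exists (exist _ k hk).
Qed.

Lemma right_option_fin_game {X L R} : is_right_option X (fin_game L R) <->
  exists2 k, k < size R & X = nth gzero R k.
Proof.
split=> [[[k hk] ->]|[k hk ->]]; first by exists k.
by exists (exist _ k hk).
Qed.

Lemma left_option_fin_game1 {X G R} :
  is_left_option X (fin_game [:: G] R) <-> X = G.
Proof. by rewrite left_option_fin_game; split=> [[[]]|->] //; exists 0. Qed.

Lemma right_option_fin_game1 {X G L} :
  is_right_option X (fin_game L [:: G]) <-> X = G.
Proof. by rewrite right_option_fin_game; split=> [[[]]|->] //; exists 0. Qed.

Lemma right_option_pow2neg {X n} : is_right_option X (pow2neg n) <->
  exists2 k, k < n & X = pow2neg k.
Proof.
rewrite pow2negE right_option_fin_game size_map size_iota.
have nthE k : k < n -> nth gzero [seq pow2neg k | k <- iota 0 n] k = pow2neg k.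
  by move=> hk; rewrite (nth_map 0) ?size_iota // nth_iota.
by split=> -[k hk ->]; exists k => //; rewrite nthE.
Qed.

Lemma pow2neg_decr {m n} : m <= n -> gle (pow2neg n) (pow2neg m).
Proof.
move=> lemn; apply: gle_dominated => X.
  move=> /left_option_fin_game1->; exists gzero; last exact: gle_refl.
  exact/left_option_fin_game1.
move=> /right_option_pow2neg[k hk ->]; exists (pow2neg k); last exact: gle_refl.
by apply/right_option_pow2neg; exists k => //; apply: leq_trans lemn.
Qed.

Lemma zero_leP G :
  gle gzero G <-> forall X, is_right_option X G -> ~ gle X gzero.
Proof. by rewrite gleP; split=> [[]|h] //; split=> // X []. Qed.

Lemma not_le_zero {X G} : is_left_option X G -> gle gzero X -> ~ gle G gzero.
Proof. by move=> hX h0 /gleP[/(_ X hX)]. Qed.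

Lemma gup_ge0 : gle gzero gup.
Proof.
apply/zero_leP => X /right_option_fin_game1->; apply: (@not_le_zero gzero).
  exact/left_option_fin_game1.
exact: gle_refl.
Qed.

Lemma gup_not_le0 : ~ gle gup gzero.
Proof.
apply: (@not_le_zero gzero); first exact/left_option_fin_game1.
exact: gle_refl.
Qed.

Lemma gadd_star_star_ge0 : gle gzero (gadd gstar gstar).
Proof.
apply/zero_leP => X /right_option_gadd[] [_ /right_option_fin_game1-> ->];
  apply: (@not_le_zero (gadd gzero gzero)); try by case: (gadd0g gzero).
- by apply: left_option_gaddr; apply/left_option_fin_game1.
by apply: left_option_gaddl; apply/left_option_fin_game1.
Qed.

(** Whatever Right moves to, Left turns one of the ups into 0 and leaves
    either up or [star + star]. *)
Lemma gadd_star_up_up_ge0 : gle gzero (gadd gstar (gadd gup gup)).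
Proof.
have gup0 : is_left_option gzero gup by apply/left_option_fin_game1.
apply/zero_leP => X /right_option_gadd[[_ /right_option_fin_game1-> ->]|].
  apply: (@not_le_zero (gadd gzero (gadd gzero gup))).
    exact/left_option_gaddr/left_option_gaddl.
  by do 2![apply: gadd_ge0; first exact: gle_refl]; apply: gup_ge0.
case=> _ /right_option_gadd[] [_ /right_option_fin_game1-> ->] ->.
  apply: (@not_le_zero (gadd gstar (gadd gstar gzero))).
    exact/left_option_gaddr/left_option_gaddr.
  apply: gle_trans (proj2 (gadd_assoc _ _ _)).
  by apply: gadd_ge0; [apply: gadd_star_star_ge0 | apply: gle_refl].
apply: (@not_le_zero (gadd gstar (gadd gzero gstar))).
  exact/left_option_gaddr/left_option_gaddl.
apply: gle_trans gadd_star_star_ge0 _; apply: gle_gadd2l.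
by case: (gadd0g gstar).
Qed.

(** A convertible equation except when [m = 0], where the left-hand side is
    [gup] itself. *)
Lemma gupsS m :
  gle (gups m.+1) (gadd gup (gups m)) /\ gle (gadd gup (gups m)) (gups m.+1).
Proof.
case: m => [|m]; last by split; apply: gle_refl.
have [leG Gle] := gadd0g gup.
split; first exact: gle_trans Gle (gadd_comm _ _).
exact: gle_trans (gadd_comm _ _) leG.
Qed.

Lemma gups_incr {m n} : m <= n -> gle (gups m) (gups n).
Proof.
move=> /subnK<-; elim: (n - m) => [|d IHd]; first exact: gle_refl.
rewrite addSn; apply: gle_trans IHd _.
by apply: gle_trans (proj2 (gupsS _)); apply: gle_addl gup_ge0.
Qed.

(** Right can only replace one of the copies of up by star, and which one makes
    no difference to the value. *)
Lemma right_option_gups {X m} :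
  is_right_option X (gups m.+1) -> gle (gadd gstar (gups m)) X.
Proof.
elim: m X => [|m IHm] X.
  move=> /right_option_fin_game1->.
  by apply: gle_trans (gadd_comm _ _) _; case: (gadd0g gstar).
move=> /right_option_gadd[[_ /right_option_fin_game1-> ->]|[Y /IHm leY ->]].
  exact: gle_refl.
apply: gle_trans (gle_gadd2l gup leY).
apply: gle_trans (proj2 (gadd_assoc _ _ _)).
apply: gle_trans (gle_gadd2r _ (gadd_comm gstar gup)).
apply: gle_trans (proj1 (gadd_assoc _ _ _)).
by apply: gle_gadd2l; case: (gupsS m).
Qed.

Lemma gups_le_right_option {k X} :
  is_right_option X (gups k.+3) -> gle (gups k) X.
Proof.
move=> /right_option_gups; apply: gle_trans.
apply: gle_trans (gle_addl (gups k) gadd_star_up_up_ge0) _.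
apply: gle_trans (proj2 (gadd_assoc _ _ _)) _; apply: gle_gadd2l.
apply: gle_trans (proj2 (gadd_assoc _ _ _)) _.
apply: gle_trans (proj2 (gupsS k.+1)); apply: gle_gadd2l.
by case: (gupsS k).
Qed.

(** * Short games *)

Lemma short_option {X G} : is_option X G -> short G -> short X.
Proof.
move=> hX [n [p hp]]; exists n, p => P hP; apply: hp.
exact: position_option hX hP.
Qed.

(** A short game may have infinitely many options, but only finitely many
    classes of identical ones, so the largest of one bound per class serves for
    all of them. *)
Lemma short_uniform_bound (G : game) (P : game -> nat -> Prop)
    (S : game -> Prop) :
    short G -> (forall X, S X -> is_option X G) ->
    (forall X Y n, gle X Y -> gle Y X -> P X n -> P Y n) ->
    (forall X m n, m <= n -> P X m -> P X n) ->
    (forall X, S X -> exists n, P X n) ->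
  exists N, forall X, S X -> P X N.
Proof.
move=> [r [p hp]] optS P_equiv P_mono exP.
(* The representatives need not be options themselves, so an unoccupied class
   receives the dummy bound 0. *)
have /fin_all_exists[f hf] : forall i : 'I_r, exists n,
    forall X, S X -> game_ext X (p i) -> P X n.
  move=> i; have [[X [SX eqX]]|none] := classic (exists X, S X /\ game_ext X (p i)).
    have [n Pn] := exP X SX; exists n => Y SY eqY.
    have [leX geX] := game_ext_gle eqX; have [leY geY] := game_ext_gle eqY.
    by apply: P_equiv Pn; [apply: gle_trans geY | apply: gle_trans geX].
  by exists 0 => X SX eqX; case: none; exists X.
exists (\max_i f i) => X SX.
have [i eqX] : exists i, game_ext X (p i).
  by apply: hp; apply: position_option (optS X SX) (position_self X).
by apply: P_mono (hf i X SX eqX); apply: leq_bigmax.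
Qed.

(** The pigeonhole step: a right option that is not below all [2^-n] is not
    below [2^-n] for all large [n], and finitely many such failures would occur
    at a common [n]. *)
Lemma glf_pow2neg_right_option {G} : short G ->
    (forall n, 0 < n -> glf G (pow2neg n)) ->
  gle G gzero \/
  exists2 X, is_right_option X G & forall n, gle X (pow2neg n).
Proof.
move=> shG ltG; apply: NNPP => /not_or_and[nG0 nX].
have [||||N hN] := @short_uniform_bound G
    (fun X n => ~ gle X (pow2neg n)) (is_right_option^~ G) shG.
- by move=> X hX; right.
- by move=> X Y n leXY leYX nle leY; apply: nle; apply: gle_trans leY.
- by move=> X m n lemn nle le; apply: nle; apply: gle_trans (pow2neg_decr lemn).
- by move=> X hX; apply: not_all_ex_not => leX; apply: nX; exists X.
have /glfE/not_gle[[X /left_option_fin_game1-> //]|[X hX leX]] := ltG N.+1 isT.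
by apply: (hN X hX); apply: gle_trans leX (pow2neg_decr (leqnSn N)).
Qed.

Theorem theorem6p4 (G : game) (hG : short G) :
  ((forall n : nat, 0 < n -> glf G (pow2neg n)) ->
     exists m : nat, 0 < m /\ glf G (gups m)) /\
  ((forall n : nat, 0 < n -> gle G (pow2neg n)) ->
     exists m : nat, 0 < m /\ gle G (gups m)).
Proof.
elim/game_option_ind: G hG => G IHL IHR hG.
have bound_right : (forall n, 0 < n -> glf G (pow2neg n)) ->
    gle G gzero \/ exists2 X, is_right_option X G & exists m, gle X (gups m).
  move=> /(glf_pow2neg_right_option hG)[|[X hX leX]]; first by left.
  have shX : short X by apply: short_option hG; right.
  have [m [_ leXm]] := proj2 (IHR X hX shX) (fun n _ => leX n).
  by right; exists X => //; exists m.
split=> [ltG|leG].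
  have [leG0|[X hX [m leX]]] := bound_right ltG.
    exists 1; split=> //; apply/glfE => geG.
    exact: gup_not_le0 (gle_trans geG leG0).
  exists m.+1; split=> //; apply/glfE => geG; apply: (right_option_not_le hX).
  by apply: gle_trans geG; apply: gle_trans leX (gups_incr (leqnSn m)).
have ltG n : 0 < n -> glf G (pow2neg n).
  move=> _; have /gleP[_ h] := leG n.+1 isT; apply/glfE; apply: h.
  by apply/right_option_pow2neg; exists n.
have [leG0|[X hX [k leX]]] := bound_right ltG.
  by exists 1; split=> //; apply: gle_trans leG0 gup_ge0.
have [||||M hM] := @short_uniform_bound G
    (fun Y n => ~ gle (gups n) Y) (is_left_option^~ G) hG.
- by move=> Y hY; left.
- by move=> Y Z n leYZ leZY nle leZ; apply: nle; apply: gle_trans leZY.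
- by move=> Y m n lemn nle leY; apply: nle; apply: gle_trans (gups_incr lemn) leY.
- move=> Y hY; have shY : short Y by apply: short_option hG; left.
  have [|m [_ /glfE nle]] := proj1 (IHL Y hY shY); last by exists m.
  by move=> n n0; have /gleP[h _] := leG n n0; apply/glfE; apply: h.
(* [M] takes care of the left options of [G], [k] and the three extra copies of
   up take care of the right options of the multiple of up. *)
exists (maxn k M).+3; split=> //; apply/gleP; split=> [Y hY leY|Y].
  apply: (hM Y hY); apply: gle_trans leY; apply: gups_incr.
  by rewrite (leq_trans (leq_maxr k M)) // -addn3 leq_addr.
move=> /gups_le_right_option leY leYG; apply: (right_option_not_le hX).
apply: gle_trans leX _; apply: gle_trans leYG; apply: gle_trans leY.
by apply: gups_incr; apply: leq_maxl.
Qed.
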